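(* Let $G_{64}$ be the explicit graph on $\mathbb{Z}_{64}$ defined in the context. (i) $G_{64}$ has diameter $4$. In particular no two vertices are at distance $\ge 5$, so no edge can be added to $G_{64}$ without creating a cycle of length at most $5$. Likewise, for every vertex $v$, no two vertices of $G_{64}-v$ are at distance $\ge 5$ in $G_{64}-v$, so no edge can be added to $G_{64}-v$ without creating a cycle of length at most $5$. (ii) For every pair of distinct vertices $\{u,v\}$ (there are $256$ orbits of such pairs under the automorphism $v\mapsto v+8$), the graph $G_{64}-\{u,v\}$ admits at most $3$ girth-preserving edge additions, and every maximal sequence of girth-preserving additions starting from $G_{64}-\{u,v\}$ results in a $3$-colourable graph. (iii) For every pair of distinct nonadjacent vertices $u,v$ of $G_{64}$ there exists a $u$--$v$ path in $G_{64}$ of length $3$, $4$ or $5$. Consequently every identification of two nonadjacent vertices of $G_{64}$ creates a cycle of length at most $5$. Identifying two adjacent vertices, that is, contracting an edge $uv$ of $G_{64}$, yields a $3$-colourable graph. Hence no $4$-chromatic graph of girth $6$ on fewer than $64$ vertices can be obtained from $G_{64}$ by deleting up to two vertices and adding girth-preserving edges, or by identifying two vertices.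
   Context: Definition of $G_{64}$: it is the simple undirected graph with vertex set $\mathbb{Z}_{64}=\{0,\dots,63\}$ whose edge set is the union of the orbits, under the map $v\mapsto v+8 \pmod{64}$, of the $20$ edges $\{i,\,i+t \bmod 64\}$ for the pairs $(i,t)$ in the list $(0,15)$, $(0,24)$, $(0,49)$, $(0,60)$, $(1,5)$, $(1,22)$, $(1,38)$, $(1,42)$, $(2,10)$, $(2,32)$, $(2,45)$, $(2,52)$, $(3,17)$, $(3,32)$, $(3,42)$, $(4,8)$, $(5,1)$, $(5,41)$, $(5,42)$, $(5,57)$. Explicitly, the orbit of the pair $(i,t)$ consists of the edges $\{v,\,v+t \bmod 64\}$ with $v\equiv i \pmod 8$. A girth-preserving edge addition to a graph $G$ of girth at least $6$ is the addition of an edge between two distinct nonadjacent vertices of $G$ which creates no cycle of length at most $5$ (equivalently, the two vertices are at distance at least $5$ in $G$). The number of girth-preserving edge additions that $G$ admits is the number of such vertex pairs. A maximal sequence of girth-preserving additions performs such additions one after another, each being girth-preserving for the current graph, until none is possible. Identifying two vertices $u,v$ means replacing them by one vertex adjacent to all neighbours of $u$ or $v$ other than $u,v$ (parallel edges are merged and, if $uv$ is an edge, it is removed). *)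

(* Defs.v *)
From mathcomp Require Import all_boot all_order all_algebra.
Set Implicit Arguments.
Unset Strict Implicit.
Unset Printing Implicit Defensive.

Record sgraph (T : finType) := SGraph {
  adj : rel T;
  adj_sym : symmetric adj;
  adj_irr : irreflexive adj }.

Section Basics.
Variables (T : finType) (G : sgraph T).

(* The sequence p lists the vertices after x, so size p is the length. *)
Definition is_path (x y : T) (p : seq T) : bool :=
  [&& path (adj G) x p, last x p == y & uniq (x :: p)].

(* Holds for every k when x and y lie in different components. *)
Definition dist_ge (x y : T) (k : nat) : Prop :=
  forall p, is_path x y p -> k <= size p.

Definition is_dist (x y : T) (k : nat) : Prop :=
  (exists2 p, is_path x y p & size p = k) /\ dist_ge x y k.

Definition has_diameter (k : nat) : Prop :=
  (forall x y, exists2 j, is_dist x y j & j <= k) /\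
  (exists x y, is_dist x y k).

Definition is_cycle (p : seq T) : bool :=
  [&& 3 <= size p, cycle (adj G) p & uniq p].

Definition has_girth (k : nat) : Prop :=
  (exists2 p, is_cycle p & size p = k) /\
  (forall p, is_cycle p -> k <= size p).

Definition colourable (k : nat) : Prop :=
  exists f : T -> 'I_k, forall x y, adj G x y -> f x != f y.

Definition chromatic (k : nat) : Prop :=
  colourable k /\ forall j, colourable j -> k <= j.

End Basics.

Section Deletion.
Variables (T : finType) (G : sgraph T) (A : {set T}).

Definition delete_adj : rel {x : T | x \notin A} :=
  fun x y => adj G (val x) (val y).

Lemma delete_sym : symmetric delete_adj.
Proof. by move=> x y; rewrite /delete_adj adj_sym. Qed.

Lemma delete_irr : irreflexive delete_adj.
Proof. by move=> x; rewrite /delete_adj adj_irr. Qed.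

Definition delete := SGraph delete_sym delete_irr.
End Deletion.

Section EdgeAddition.
Variables (T : finType) (G : sgraph T) (u v : T).

Definition add_edge_adj : rel T := fun x y =>
  adj G x y || (u != v) && ([set x; y] == [set u; v]).

Lemma add_edge_sym : symmetric add_edge_adj.
Proof. by move=> x y; rewrite /add_edge_adj adj_sym setUC. Qed.

Lemma add_edge_irr : irreflexive add_edge_adj.
Proof.
move=> x; rewrite /add_edge_adj adj_irr /= setUid.
apply/andP=> -[uv /eqP/setP E].
have := E u; have := E v; rewrite !inE !eqxx orbT /= => /eqP vx /eqP ux.
by rewrite ux vx eqxx in uv.
Qed.

Definition add_edge := SGraph add_edge_sym add_edge_irr.

Definition addition_creates_short_cycle : bool :=
  [exists k : 'I_6, [exists p : k.-tuple T,
    is_cycle add_edge p && ~~ is_cycle G p]].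

Definition girth_preserving : bool :=
  [&& u != v, ~~ adj G u v & ~~ addition_creates_short_cycle].
End EdgeAddition.

Definition num_girth_preserving (T : finType) (G : sgraph T) : nat :=
  #|[set e : {set T} | [exists u, exists v,
      (e == [set u; v]) && girth_preserving G u v]]|.

Inductive additions (T : finType) (G : sgraph T) : sgraph T -> Prop :=
| additions_nil : additions G G
| additions_step H u v :
    additions G H -> girth_preserving H u v -> additions G (add_edge H u v).

Definition maximal_additions (T : finType) (G H : sgraph T) : Prop :=
  additions G H /\ forall u v, ~~ girth_preserving H u v.

Section Identification.
Variables (T : finType) (G : sgraph T) (u v : T).

(* None is the vertex that replaces u and v. *)
Definition identified := option {x : T | x \notin [set u; v]}.

Definition identify_adj : rel identified := fun X Y =>
  match X, Y with
  | Some x, Some y => adj G (val x) (val y)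
  | None, Some y => adj G u (val y) || adj G v (val y)
  | Some x, None => adj G u (val x) || adj G v (val x)
  | None, None => false
  end.

Lemma identify_sym : symmetric identify_adj.
Proof. by case=> [x|] [y|] //=; rewrite adj_sym. Qed.

Lemma identify_irr : irreflexive identify_adj.
Proof. by case=> [x|] //=; rewrite adj_irr. Qed.

Definition identify := SGraph identify_sym identify_irr.

(* The quotient map: insub returns None exactly on u and v. *)
Definition identify_map (x : T) : identified := insub x.

(* A cycle is created when it is not the image of a cycle of G. *)
Definition identification_creates_short_cycle : bool :=
  [exists k : 'I_6, [exists p : k.-tuple identified,
    is_cycle identify p &&
    ~~ [exists q : k.-tuple T,
          is_cycle G q && (map identify_map q == p)]]].
End Identification.

Inductive obtained_from (T : finType) (G : sgraph T) :
    forall T' : finType, sgraph T' -> Prop :=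
| obtained_by_deletion (A : {set T}) H :
    #|A| <= 2 -> additions (delete G A) H -> obtained_from G H
| obtained_by_identification u v :
    u != v -> obtained_from G (identify G u v).

Definition G64_edges : seq (nat * nat) :=
  [:: (0, 15); (0, 24); (0, 49); (0, 60); (1, 5); (1, 22); (1, 38); (1, 42);
      (2, 10); (2, 32); (2, 45); (2, 52); (3, 17); (3, 32); (3, 42); (4, 8);
      (5, 1); (5, 41); (5, 42); (5, 57)].

Definition G64_arc (x y : nat) : bool :=
  has (fun it => (x %% 8 == it.1) && (y == (x + it.2) %% 64)) G64_edges.

Definition G64_adj : rel 'Z_64 := fun x y => G64_arc x y || G64_arc y x.

Lemma G64_sym : symmetric G64_adj.
Proof. by move=> x y; rewrite /G64_adj orbC. Qed.

Lemma G64_irr : irreflexive G64_adj.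
Proof.
have H : all (fun n => ~~ G64_arc n n) (iota 0 64) by [].
move=> x; rewrite /G64_adj orbb; apply/negbTE/(allP H).
by rewrite mem_iota; exact: ltn_ord x.
Qed.

Definition G64 : sgraph 'Z_64 := SGraph G64_sym G64_irr.

Definition shift8 (x : 'Z_64) : 'Z_64 := (x + 8%:R)%R.

(* Main.v *)
Require Import Defs.
From mathcomp Require Import all_boot all_order all_algebra.
Set Implicit Arguments. Unset Strict Implicit. Unset Printing Implicit Defensive.
Import GRing.Theory.

(** Two finite certificates carry the whole result: the list of all short
paths of G64, and twenty 3-colourings.

Distances.  Enumerating the simple paths of length at most 4 from every
vertex shows that any two vertices x, y are joined by such a path, even
after the deletion of any third vertex ([robustG]).  It also yields the finitely many
quadruples u, v, x, y for which the deletion of u and v destroys every such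
path between x and y; call the pair x, y critical for u, v.  Only critical
pairs can be added to G64 - {u, v} ([far_critical]), and each u, v has at
most three of them ([size_critical_for]).

Colourings.  The graph has twenty orbits of edges under rotation by 8, and
for each of them there is a 3-colouring of the vertices in which one edge of
the orbit is the only monochromatic edge.  Up to rotation such a
near-colouring exists for every edge ab, and it settles the contraction of
ab, because a and b share a colour and every other edge is properly coloured
([contraction_colouring]).  It is also proper on G64 minus any set that
contains a or b.  For every u, v one of these near-colourings has its
monochromatic edge at u or v and moreover separates all pairs critical for
u, v at once ([deletion_colouring]).

Additions.  Adding edges never lengthens a distance, so every edge added in
the course of a sequence of girth-preserving additions was already admissible
in the initial graph ([additions_adj]).  Hence the colouring just described
is proper on every graph reached from G64 - {u, v}, maximal or not; the case
u = v covers the deletion of one vertex.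

Identifications.  Two nonadjacent vertices are joined by a path of length 3
or 4, which becomes a cycle of the same length when its ends are identified.
As G64 has no cycle of length at most 5 ([girth_G64]), that cycle is new.

Finally, the 256 orbits of pairs are counted by their sizes: the 32 pairs
{x, x + 32} form orbits of size 4, the other 1984 pairs orbits of size 8
([fcard_pairs]). *)

(** * Short paths, edge additions and identifications *)

Lemma set2_inj (T : finType) (x y u v : T) :
  u != v -> [set x; y] = [set u; v] -> x = u /\ y = v \/ x = v /\ y = u.
Proof.
move=> uv E; have := set21 x y; rewrite E => /set2P[xu|xv]; [left|right].
  have := set22 u v; rewrite -E xu => /set2P[vu|->] //.
  by rewrite vu eqxx in uv.
have := set21 u v; rewrite -E xv => /set2P[vu|->] //.
by rewrite vu eqxx in uv.
Qed.

Lemma notin_set2 (T : finType) (x u v : T) :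
  x \notin [set u; v] -> u != x /\ v != x.
Proof. by rewrite !inE negb_or ![x == _]eq_sym => /andP. Qed.

Lemma map_val_pmap_insub (T : finType) (A : {set T}) (p : seq T) :
  all [predC A] p -> map val (pmap insub p : seq {z | z \notin A}) = p.
Proof.
move=> Ap; rewrite (pmap_filter (insubK _)); apply/all_filterP.
by apply: sub_all Ap => z /= zA; rewrite insubT.
Qed.

Section ShortPaths.
Variables (T : finType) (G : sgraph T).
Implicit Types (x y u v : T) (p : seq T).

(** The path closes up with the new edge to a cycle of length at most 5;
nonadjacency of its ends makes the path long enough for that. *)
Lemma short_path_blocks_addition x y p :
  x != y -> ~~ adj G x y -> is_path G x y p -> size p <= 4 ->
  addition_creates_short_cycle G x y.
Proof.
move=> xy nadj /and3P[Gp /eqP lastp Up] sp.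
have sp3 : (size (x :: p) < 6)%N by [].
apply/existsP; exists (Ordinal sp3); apply/existsP; exists (in_tuple (x :: p)).
rewrite /is_cycle [tval _]/= Up !andbT [cycle (adj G) _]/= rcons_path lastp.
rewrite (adj_sym G) (negbTE nadj) !andbF andbT /= rcons_path lastp !ltnS.
apply/andP; split.
  case: p lastp Gp {Up sp sp3} => [|z [|? ?]] //= => [/eqP|->].
    by rewrite (negbTE xy).
  by rewrite andbT (negbTE nadj).
rewrite (sub_path _ Gp) /=; last by move=> a b /= ab; rewrite /add_edge_adj ab.
by rewrite /add_edge_adj xy setUC eqxx orbT.
Qed.

Lemma girth_preserving_far x y p :
  girth_preserving G x y -> is_path G x y p -> 4 < size p.
Proof.
case/and3P=> xy nadj safe Gp; rewrite ltnNge; apply: contra safe.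
exact: short_path_blocks_addition.
Qed.

Lemma dist_of_path x y p : is_path G x y p ->
  exists2 j, is_dist G x y j & j <= size p.
Proof.
move=> Gp; pose P n := [exists q : n.-tuple T, is_path G x y q].
have Pex : exists n, P n by exists (size p); apply/existsP; exists (in_tuple p).
case: (ex_minnP Pex) => n /existsP[q Gq] min_n.
have far r : is_path G x y r -> n <= size r.
  by move=> Gr; apply: min_n; apply/existsP; exists (in_tuple r).
exists n; last exact: far.
by split=> //; exists q; rewrite ?size_tuple.
Qed.

End ShortPaths.

Section Operations.
Variables (T : finType) (G : sgraph T).
Implicit Types (x y u v : T) (p : seq T).

Lemma additions_mono H x y : additions G H -> adj G x y -> adj H x y.
Proof. by elim=> // K u v _ IH _ /IH /= Kxy; rewrite /add_edge_adj Kxy. Qed.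

(** An added edge joined two vertices that were far apart at that moment, and
these were at least as far apart in [G], which has fewer edges. The last two
cases differ only in the direction in which the paths are read. *)
Lemma additions_adj H x y : additions G H -> adj H x y ->
  [\/ adj G x y, forall p, is_path G x y p -> 4 < size p
    | forall p, is_path G y x p -> 4 < size p].
Proof.
elim=> [|K u v GK IH far /= /orP[/IH //|/andP[uv /eqP E]]]; first by constructor 1.
have farG p : is_path G u v p -> 4 < size p.
  case/and3P=> Gp ? ?; apply: (girth_preserving_far far); apply/and3P; split=> //.
  by apply: sub_path Gp => a b; apply: additions_mono.
by case: (set2_inj uv E) => -[-> ->]; [constructor 2|constructor 3].
Qed.

Lemma lift_path (A : {set T}) (x y : {z | z \notin A}) p :
  is_path G (val x) (val y) p -> all [predC A] p ->
  exists2 q, is_path (delete G A) x y q & size q = size p.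
Proof.
move=> Gp Ap.
have valK := map_val_pmap_insub Ap.
exists (pmap insub p); last by rewrite -[in RHS]valK size_map.
rewrite -[p]valK in Gp; move: (pmap _ _) Gp => q /and3P[Gq Lq Uq].
apply/and3P; split; first by rewrite path_map in Gq.
  by rewrite last_map in Lq.
by rewrite -map_cons (map_inj_uniq val_inj) in Uq.
Qed.

(** The interior of the path, closed up through the merged vertex, is a cycle
of length [size p]. It is not the image of a cycle of [G], since such a cycle
would have length at most 5. *)
Lemma identification_short_cycle u v p : u != v ->
  (forall q, is_cycle G q -> 5 < size q) ->
  is_path G u v p -> size p \in [:: 3; 4; 5] ->
  identification_creates_short_cycle G u v.
Proof.
move=> uv girthG; case/lastP: p => // p w; rewrite /is_path last_rcons.
case/and3P=> Gp /eqP wv; rewrite {w}wv in Gp *.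
rewrite /= mem_rcons rcons_uniq inE negb_or uv /=.
case/and3P=> up vp Up; rewrite size_rcons => sp.
have Ap : all [predC [set u; v]] p.
  apply/allP=> z zp; rewrite !inE negb_or.
  by rewrite (memPn up) // (memPn vp).
pose q : seq {z | z \notin [set u; v]} := pmap insub p.
have valK : map val q = p by apply: map_val_pmap_insub.
have sq : size q = size p by rewrite -[in RHS]valK size_map.
have sq6 : (size (None :: map Some q) < 6)%N.
  by rewrite /= size_map sq; case: (size p) sp => [|[|[|[|[|]]]]].
apply/existsP; exists (Ordinal sq6); apply/existsP.
exists (in_tuple (None :: map Some q)); apply/andP; split; last first.
  apply/existsPn=> r; apply/negP=> /andP[/girthG].
  by rewrite size_tuple ltnNge -ltnS sq6.
rewrite /is_cycle /= size_map sq; apply/and3P; split.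
- by case: (size p) sp => [|[|[|[|[|]]]]].
- move: Gp; rewrite -valK; move: sp; rewrite -sq.
  case: (q) => [|a s] // _; rewrite /= !rcons_path /= !last_map.
  case/and3P=> ua Gs lv; rewrite ua /= [adj G v _]adj_sym lv orbT andbT.
  by rewrite path_map in Gs; rewrite path_map.
rewrite (map_inj_uniq Some_inj) -(map_inj_uniq val_inj) valK Up andbT.
by apply/mapP=> -[].
Qed.

(** The common colour of [u] and [v] goes to the merged vertex; no edge other
than [uv] is monochromatic, and that one disappears. *)
Lemma identify_colourable u v k (f : T -> 'I_k) : adj G u v -> f u = f v ->
  (forall x y, adj G x y -> f x = f y -> [set x; y] = [set u; v]) ->
  colourable (identify G u v) k.
Proof.
move=> Guv fuv mono.
pose h (X : identified u v) := if X is Some x then f (val x) else f u.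
have none (y : {z | z \notin [set u; v]}) :
    adj G u (val y) || adj G v (val y) -> f u != f (val y).
  case: y => y yN /= adjy; apply/eqP=> fy; move/negP: yN; apply.
  by case/orP: adjy => /mono <-; rewrite ?inE ?eqxx ?orbT // -fuv.
exists h => -[x|] [y|] //=; last exact: none.
  case: x y => [x xN] [y yN] /= xy; apply/eqP=> /(mono _ _ xy) E.
  by rewrite -E !inE eqxx in xN.
by rewrite eq_sym; apply: none.
Qed.

End Operations.

(** The set of admissible pairs is contained in the image of [s] under
[ends]; [s] is typically a list of codes for unordered pairs. *)
Lemma num_girth_preserving_le (T : finType) (G : sgraph T) (K : eqType)
    (s : seq K) (ends : K -> {set T}) :
  (forall x y, girth_preserving G x y -> exists2 k, k \in s & [set x; y] = ends k) ->
  num_girth_preserving G <= size s.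
Proof.
move=> gp_s; rewrite -(size_map ends); apply: leq_trans (card_size _).
apply/subset_leq_card/subsetP=> e.
rewrite inE => /existsP[x /existsP[y /andP[/eqP-> /gp_s[k ks ->]]]].
exact: map_f.
Qed.

(** * Enumeration of simple paths and of blocking pairs *)

Section SimplePaths.
Variables (T : eqType) (nb : T -> seq T).

Fixpoint simple_paths n x avoid : seq (seq T) :=
  [::] :: if n isn't m.+1 then [::] else
    [seq y :: p | y <- [seq y <- nb x | y \notin avoid],
                  p <- simple_paths m y (y :: avoid)].

Lemma mem_simple_paths n x avoid p : p \in simple_paths n x avoid =
  [&& size p <= n, path (fun a b => b \in nb a) x p, uniq p
    & ~~ has (mem avoid) p].
Proof.
elim: n x avoid p => [|n IH] x avoid [|y p] //.
rewrite in_cons /= ltnS; apply/allpairsPdep/and3P => [[z [q [+ + [-> ->]]]]|].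
  rewrite mem_filter IH => /andP[za xz] /and4P[-> -> -> qza].
  rewrite xz negb_or za !andbT; split=> //; apply/andP; split.
    by apply: contra qza => zq; apply/hasP; exists z; rewrite ?inE ?eqxx.
  by apply: contra qza; apply: sub_has => a /= aa; rewrite inE aa orbT.
case=> sp /andP[xy yp] /andP[/andP[ynp up]].
rewrite negb_or => /andP[ya pa].
exists y, p; split=> //; first by rewrite mem_filter ya.
rewrite IH sp yp up; apply/hasPn=> a ap; rewrite /= inE negb_or.
by rewrite (memPn ynp) //= (hasPn pa).
Qed.

End SimplePaths.

Definition upair a b := (minn a b, maxn a b).

Lemma upairC a b : upair a b = upair b a.
Proof. by rewrite /upair minnC maxnC. Qed.

Lemma upair_inj a b c d :
  upair a b = upair c d -> a = c /\ b = d \/ a = d /\ b = c.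
Proof.
rewrite /upair; case: (leqP a b) => ab; case: (leqP c d) => cd [-> ->];
  by [left | right].
Qed.

(** [Ps] stands for the list of short paths from some vertex to [y]; each path
is given without its starting point, so that only [y] has to be excluded when
inner vertices are meant. *)
Section Blocking.
Variables (Ps : seq (seq nat)) (y : nat).

Definition avoids u (p : seq nat) := u \notin p.

(** If no path of [Ps] avoids both [u] and [v], then one of them, say [u], lies
on the first path, and [v] lies on the first path that avoids [u]. So only the
inner vertices of these two paths have to be tried. *)
Definition blocking_pairs : seq (nat * nat) :=
  [seq upair uv.1 uv.2
     | uv <- [seq (u, v) | u <- head [::] Ps, v <- head [::] (filter (avoids u) Ps)]
     & [&& uv.1 != y, uv.2 != y
         & ~~ has (fun p => avoids uv.1 p && avoids uv.2 p) Ps]].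

(** It is enough to test the vertices of the first path, as this path itself
avoids all the others. *)
Definition robust : bool :=
  (Ps != [::]) && all (fun u => (u == y) || has (avoids u) Ps) (head [::] Ps).

Lemma robust_avoids u : robust -> u != y -> has (avoids u) Ps.
Proof.
case/andP; case: Ps => //= p s _ /allP Pu uy.
have [up|] := boolP (u \in p); last by rewrite /avoids => ->.
by have := Pu _ up; rewrite (negbTE uy).
Qed.

Lemma blocking_pairsP u v : robust -> u != y -> v != y ->
  has (fun p => avoids u p && avoids v p) Ps || (upair u v \in blocking_pairs).
Proof.
move=> rob uy vy; rewrite -implyNb; apply/implyP=> nouv.
wlog up : u v uy vy nouv / u \in head [::] Ps.
  move=> wl; have [up|nup] := boolP (u \in head [::] Ps); first exact: wl.
  have [vp|nvp] := boolP (v \in head [::] Ps).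
    rewrite upairC; apply: wl => //; apply: contra nouv.
    by apply: sub_has => p; rewrite andbC.
  case/andP: rob; case: (Ps) nouv nup nvp => //= p s + nup nvp.
  by rewrite /avoids nup nvp.
apply/mapP; exists (u, v) => //; rewrite mem_filter /= uy vy nouv.
apply/allpairsPdep; exists u, v; split=> //.
move: (robust_avoids rob uy); rewrite has_filter.
case E: (filter _ _) => [//|q s] _ /=; apply: contraNT nouv => vq.
have : q \in filter (avoids u) Ps by rewrite E mem_head.
rewrite mem_filter => /andP[uq qPs].
by apply/hasP; exists q; rewrite // uq.
Qed.

End Blocking.

(** * The short paths of G64 *)

Definition linked x y := G64_arc x y || G64_arc y x.

(** Vertices are represented by natural numbers below 64, on which the
searches below can be evaluated. *)
Definition neighbour_table : seq (seq nat) := Eval vm_compute in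
  [seq [seq y <- iota 0 64 | linked x y] | x <- iota 0 64].

Definition neighbours x := nth [::] neighbour_table x.

Lemma mem_neighbours x y : x < 64 -> y \in neighbours x = (y < 64) && linked x y.
Proof.
move=> x64; rewrite /neighbours.
have -> : neighbour_table = [seq [seq y <- iota 0 64 | linked x y] | x <- iota 0 64].
  by vm_compute.
by rewrite (nth_map 0) ?size_iota // nth_iota // mem_filter mem_iota andbC.
Qed.

Lemma adjE (x y : 'Z_64) : adj G64 x y = ((y : nat) \in neighbours x).
Proof. by rewrite (mem_neighbours _ (ltn_ord x)) (ltn_ord y). Qed.

Definition paths_from n x := simple_paths neighbours n x [:: x].

Lemma mem_paths_from n (x : 'Z_64) (p : seq 'Z_64) :
  (map val p \in paths_from n x) = is_path G64 x (last x p) p && (size p <= n).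
Proof.
rewrite mem_simple_paths size_map andbC; congr (_ && _).
rewrite /is_path eqxx /= path_map (map_inj_uniq val_inj) andbA [RHS]andbA andbAC.
rewrite (eq_path (_ : relpre val _ =2 adj G64)) => [|a b]; last exact/esym/adjE.
congr (_ && _); rewrite has_map (eq_has (_ : _ =1 pred1 x)) ?has_pred1 // => a.
by rewrite /= inE.
Qed.

Lemma paths_from_val n (x : 'Z_64) p :
  p \in paths_from n x -> exists q : seq 'Z_64, p = map val q.
Proof.
rewrite mem_simple_paths => /and3P[_ + _].
elim: p {n}x => [|y p IH] x /=; first by exists [::].
rewrite (mem_neighbours _ (ltn_ord x)) => /andP[/andP[y64 _]].
by case/(IH (Ordinal (y64 : y < (Zp_trunc 64).+2))) => q ->; exists (Ordinal y64 :: q).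
Qed.

Definition ending x y (Ps : seq (seq nat)) := [seq p <- Ps | last x p == y].

Lemma has_ending n (x y : 'Z_64) (P : pred (seq nat)) :
  has P (ending x y (paths_from n x)) ->
  exists p, [/\ is_path G64 x y p, size p <= n & P (map val p)].
Proof.
case/hasP=> p; rewrite mem_filter => /andP[/eqP lp px] Pp.
have [q pq] := paths_from_val px; move: lp px Pp; rewrite {p}pq => lp.
rewrite mem_paths_from => /andP[Gq sq] Pq; exists q; split=> //.
by rewrite last_map in lp; rewrite -(val_inj lp).
Qed.

(** The entries [((u, v), (x, y))] such that the deletion of [u] and [v]
destroys all paths of length at most 4 between [x] and [y]. *)
Definition critical_search : seq ((nat * nat) * (nat * nat)) :=
  undup (flatten [seq (let Ps := paths_from 4 x in
    flatten [seq [seq (uv, upair x y) | uv <- blocking_pairs (ending x y Ps) y]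
      | y <- iota 0 64 & y != x]) | x <- iota 0 64]).

Definition critical_table : seq ((nat * nat) * (nat * nat)) :=
  Eval vm_compute in critical_search.

Definition critical (u v x y : 'Z_64) := (upair u v, upair x y) \in critical_table.

(** For all [x] and [y], no single vertex other than [y] meets all paths of
length at most 4 from [x] to [y]: this contains both distance statements about
[G64] and about [G64] minus one vertex. *)
Lemma all_robust : all (fun x => let Ps := paths_from 4 x in
  all (fun y => (x == y) || robust (ending x y Ps) y) (iota 0 64)) (iota 0 64).
Proof. by vm_compute. Qed.

Lemma Z64_iota (x : 'Z_64) : (x : nat) \in iota 0 64.
Proof. by rewrite mem_iota ltn_ord. Qed.

Lemma robustG (x y : 'Z_64) : x != y -> robust (ending x y (paths_from 4 x)) y.
Proof.
move=> xy; have /= := allP (allP all_robust _ (Z64_iota x)) _ (Z64_iota y).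
by rewrite (inj_eq val_inj) (negbTE xy).
Qed.

Lemma critical_tableP (u v x y : 'Z_64) : x != y ->
  upair u v \in blocking_pairs (ending x y (paths_from 4 x)) y -> critical u v x y.
Proof.
move=> xy uv; rewrite /critical.
have -> : critical_table = critical_search by vm_compute.
rewrite mem_undup; apply/flatten_mapP; exists (x : nat); first exact: Z64_iota.
apply/flatten_mapP; exists (y : nat).
  by rewrite mem_filter Z64_iota andbT eq_sym.
by apply/mapP; exists (upair u v).
Qed.

Lemma short_path x y : exists2 p, is_path G64 x y p & size p <= 4.
Proof.
have [->|xy] := eqVneq x y; first by exists [::]; rewrite // /is_path /= eqxx.
have [] := @has_ending 4 x y predT; last by move=> p []; exists p.
by have /andP[+ _] := robustG xy; case: (ending _ _ _).
Qed.

(** Here [u = v] is allowed, which covers the deletion of a single vertex. *)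
Lemma short_path_avoiding x y u v : x != y ->
  u != x -> u != y -> v != x -> v != y ->
  (exists p, [/\ is_path G64 x y p, size p <= 4, u \notin p & v \notin p])
  \/ critical u v x y.
Proof.
move=> xy ux uy vx vy.
have /orP[] := @blocking_pairsP _ _ u v (robustG xy) uy vy; last first.
  by right; apply: critical_tableP.
case/has_ending=> p [Gp sp /andP[up vp]]; left; exists p.
by rewrite /avoids !(mem_map val_inj) in up vp.
Qed.

(** A short cycle is a path of length at most 4 whose end is adjacent to its
start. *)
Lemma girth_G64 p : is_cycle G64 p -> 5 < size p.
Proof.
case: p => // x p /and3P[sp + Up].
rewrite /= rcons_path => /andP[Gp lp]; rewrite ltnNge; apply/negP=> sp5.
have px : map val p \in paths_from 4 x by rewrite mem_paths_from /is_path Gp eqxx Up.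
have chk : all (fun x => all (fun p => (size p < 2) || (x \notin neighbours (last x p)))
  (paths_from 4 x)) (iota 0 64) by vm_compute.
have := allP (allP chk _ (Z64_iota x)) _ px.
by rewrite /= size_map last_map -adjE /= lp ltnNge -ltnS sp.
Qed.

Definition detour_or_adj x y Ps :=
  [|| x == y, y \in neighbours x | has (fun p => 2 < size p) (ending x y Ps)].

Lemma all_detour_or_adj : all (fun x => let Ps := paths_from 4 x in
  all (fun y => detour_or_adj x y Ps) (iota 0 64)) (iota 0 64).
Proof. by vm_compute. Qed.

(** Even two vertices at distance 2 are joined by a path of length 4. *)
Lemma path_345 x y : x != y -> ~~ adj G64 x y ->
  exists2 p, is_path G64 x y p & size p \in [:: 3; 4; 5].
Proof.
move=> xy nadj; have : detour_or_adj x y (paths_from 4 x).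
  exact: allP (allP all_detour_or_adj _ (Z64_iota x)) _ (Z64_iota y).
rewrite /detour_or_adj (inj_eq val_inj) (negbTE xy) -adjE (negbTE nadj) orFb orFb.
case/(@has_ending 4 x y (fun p => 2 < size p))=> q [Gq sq].
rewrite size_map => q3; exists q; first exact: Gq.
by case: (size q) q3 sq => [|[|[|[|[|]]]]].
Qed.

Lemma diameter_G64 : has_diameter G64 4.
Proof.
split=> [x y|].
  have [p Gp sp] := short_path x y; have [j dj jp] := dist_of_path Gp.
  by exists j => //; apply: leq_trans sp.
(* The vertex 6 is at distance 4 from 0. *)
exists ord0, (inZp 6); have far : dist_ge G64 ord0 (inZp 6) 4.
  move=> p Gp; rewrite leqNgt; apply/negP=> sp.
  have /and3P[_ /eqP lp _] := Gp.
  have : map val p \in paths_from 3 (val (ord0 : 'Z_64)).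
    by rewrite mem_paths_from lp Gp.
  have chk : let x0 := val (ord0 : 'Z_64) in
    all (fun p => last x0 p != 6) (paths_from 3 x0) by vm_compute.
  by move/(allP chk); rewrite last_map lp.
have [p Gp sp] := short_path ord0 (inZp 6); split=> //; exists p => //.
by apply/eqP; rewrite eqn_leq sp far.
Qed.

(** * Near-colourings *)

Definition edges : seq (nat * nat) := Eval vm_compute in
  [seq xy <- [seq (x, y) | x <- iota 0 64, y <- neighbours x] | xy.1 < xy.2].

Lemma mem_edges (x y : 'Z_64) : adj G64 x y -> upair x y \in edges.
Proof.
have -> : edges = [seq xy <- [seq (x, y) | x <- iota 0 64, y <- neighbours x]
                      | xy.1 < xy.2].
  by vm_compute.
wlog xy : x y / x < y => [wl|].
  have [xy|yx|/val_inj->] := ltngtP x y; first exact: wl.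
    by rewrite upairC adj_sym; apply: wl.
  by rewrite adj_irr.
rewrite adjE /upair (minn_idPl (ltnW xy)) (maxn_idPr (ltnW xy)) => adjxy.
rewrite mem_filter; apply/andP; split; first exact: xy.
apply/allpairsPdep; exists (x : nat), (y : nat); split; [exact: Z64_iota|exact: adjxy|].
by [].
Qed.

(** One 3-colouring for each entry [(i, t)] of [G64_edges], in the same order;
its only monochromatic edge joins [i] and [(i + t) %% 64]. An edge may have
several such colourings; those taken here make [critical_pairs_checked] hold. *)
Definition near_colourings : seq (seq nat) := [::
  [:: 0; 2; 0; 0; 0; 2; 0; 0; 1; 0; 1; 0; 1; 2; 1; 0; 0; 1; 2; 1; 2;
      2; 0; 0; 1; 2; 2; 1; 1; 1; 0; 1; 0; 2; 1; 1; 0; 2; 1; 0; 1; 2; 2;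
      1; 2; 2; 0; 1; 0; 2; 0; 2; 0; 2; 1; 0; 1; 2; 1; 0; 2; 2; 0; 1];
  [:: 0; 2; 1; 0; 0; 2; 1; 2; 1; 1; 0; 2; 2; 0; 2; 1; 0; 0; 2; 1; 1;
      0; 1; 0; 0; 2; 0; 0; 0; 0; 1; 2; 2; 0; 0; 1; 2; 0; 1; 1; 1; 0; 2;
      1; 1; 2; 1; 0; 2; 1; 0; 2; 0; 0; 2; 2; 1; 0; 2; 1; 2; 0; 1; 1];
  [:: 0; 0; 2; 1; 1; 0; 1; 2; 2; 0; 0; 2; 0; 0; 2; 1; 2; 1; 2; 1; 2;
      0; 2; 1; 1; 0; 1; 1; 1; 0; 1; 1; 0; 1; 0; 2; 0; 0; 2; 2; 1; 0; 2;
      1; 2; 0; 1; 1; 0; 0; 0; 2; 0; 0; 1; 2; 1; 0; 0; 2; 2; 0; 1; 1];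
  [:: 0; 2; 1; 2; 1; 2; 0; 1; 0; 1; 0; 0; 0; 2; 0; 1; 1; 0; 1; 1; 1;
      2; 1; 1; 2; 1; 2; 0; 2; 2; 0; 0; 1; 2; 0; 0; 0; 2; 1; 1; 2; 2; 2;
      1; 2; 0; 1; 0; 1; 2; 2; 0; 1; 2; 0; 1; 0; 2; 0; 1; 0; 2; 1; 0];
  [:: 1; 0; 1; 0; 1; 2; 0; 2; 0; 1; 1; 2; 0; 1; 0; 0; 1; 1; 2; 0; 2;
      2; 0; 1; 0; 1; 1; 1; 0; 1; 2; 2; 2; 1; 2; 2; 2; 1; 0; 2; 0; 2; 0;
      1; 0; 2; 1; 0; 2; 0; 1; 2; 1; 0; 2; 2; 0; 1; 0; 2; 0; 1; 0; 0];
  [:: 0; 0; 0; 0; 0; 0; 1; 0; 1; 0; 0; 2; 1; 0; 1; 2; 2; 1; 2; 2; 2;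
      2; 0; 0; 1; 2; 2; 1; 1; 2; 1; 1; 0; 1; 1; 1; 0; 0; 2; 2; 1; 0; 2;
      1; 2; 1; 2; 1; 0; 2; 0; 1; 0; 0; 1; 2; 1; 0; 1; 2; 2; 0; 1; 1];
  [:: 2; 0; 2; 1; 2; 0; 1; 0; 1; 2; 2; 0; 1; 2; 0; 1; 2; 2; 0; 1; 0;
      2; 1; 2; 1; 2; 2; 2; 1; 2; 0; 0; 0; 2; 0; 0; 0; 2; 1; 0; 1; 0; 1;
      1; 1; 0; 2; 1; 0; 1; 2; 0; 2; 1; 0; 0; 1; 2; 1; 0; 0; 2; 1; 1];
  [:: 0; 0; 1; 2; 2; 0; 1; 0; 1; 1; 2; 1; 0; 2; 0; 1; 2; 2; 0; 1; 1;
      2; 1; 2; 2; 0; 1; 2; 2; 2; 1; 0; 0; 2; 0; 0; 0; 2; 1; 1; 1; 0; 0;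
      0; 1; 0; 1; 2; 0; 1; 2; 0; 2; 2; 0; 0; 1; 2; 0; 1; 1; 2; 1; 1];
  [:: 2; 0; 0; 0; 1; 0; 1; 2; 0; 0; 1; 1; 0; 0; 2; 0; 1; 0; 2; 0; 2;
      1; 2; 2; 1; 1; 1; 1; 0; 0; 2; 2; 1; 0; 1; 2; 2; 1; 2; 2; 0; 1; 0;
      2; 0; 1; 2; 2; 2; 0; 1; 2; 1; 0; 2; 2; 0; 1; 0; 2; 0; 1; 2; 0];
  [:: 0; 1; 0; 1; 0; 1; 0; 2; 1; 0; 0; 0; 1; 1; 2; 1; 0; 1; 2; 1; 2;
      0; 2; 2; 1; 0; 0; 0; 1; 1; 2; 2; 0; 1; 0; 2; 2; 0; 2; 2; 1; 0; 1;
      2; 1; 0; 2; 2; 0; 1; 0; 2; 0; 1; 2; 2; 1; 0; 1; 2; 1; 0; 2; 1];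
  [:: 1; 1; 0; 0; 2; 1; 0; 2; 0; 1; 1; 0; 1; 1; 2; 0; 2; 1; 2; 1; 2;
      1; 0; 2; 0; 1; 0; 2; 1; 1; 2; 0; 2; 1; 1; 2; 2; 1; 2; 2; 0; 2; 0;
      2; 0; 1; 0; 0; 2; 0; 1; 0; 1; 1; 2; 2; 0; 1; 1; 0; 0; 0; 2; 0];
  [:: 2; 1; 0; 1; 0; 2; 0; 0; 1; 0; 2; 0; 1; 1; 2; 0; 0; 1; 1; 1; 0;
      1; 0; 0; 1; 2; 1; 0; 2; 1; 0; 1; 0; 1; 2; 0; 0; 1; 0; 0; 1; 2; 1;
      2; 1; 2; 0; 1; 2; 1; 2; 2; 2; 2; 0; 0; 1; 2; 2; 2; 1; 2; 0; 0];
  [:: 0; 1; 0; 0; 0; 1; 0; 0; 1; 1; 1; 0; 1; 1; 0; 2; 0; 1; 1; 0; 0;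
      1; 0; 0; 2; 1; 2; 0; 2; 1; 0; 2; 0; 1; 1; 2; 1; 1; 2; 0; 2; 1; 2;
      2; 2; 1; 0; 2; 0; 1; 0; 2; 0; 1; 2; 0; 2; 0; 1; 2; 1; 1; 2; 2];
  [:: 2; 1; 2; 0; 1; 1; 0; 2; 0; 1; 0; 0; 0; 1; 0; 0; 2; 0; 2; 0; 2;
      1; 2; 2; 0; 1; 1; 2; 1; 1; 0; 0; 2; 1; 1; 0; 2; 2; 0; 2; 0; 1; 1;
      2; 0; 1; 2; 0; 2; 1; 1; 2; 2; 1; 0; 2; 0; 1; 0; 1; 0; 1; 2; 0];
  [:: 2; 0; 2; 0; 1; 0; 1; 1; 0; 2; 2; 1; 0; 0; 1; 1; 1; 0; 2; 1; 1;
      0; 1; 1; 0; 2; 0; 2; 0; 2; 1; 0; 2; 0; 0; 1; 2; 0; 2; 1; 0; 2; 0;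
      2; 1; 0; 1; 1; 2; 0; 1; 0; 2; 2; 1; 1; 0; 2; 2; 1; 0; 0; 1; 1];
  [:: 2; 1; 1; 0; 0; 1; 0; 0; 1; 2; 1; 2; 0; 2; 0; 0; 2; 1; 1; 0; 2;
      1; 0; 0; 1; 2; 1; 0; 0; 2; 0; 0; 2; 1; 2; 1; 2; 1; 0; 0; 1; 2; 2;
      0; 1; 1; 0; 0; 2; 1; 2; 1; 0; 1; 0; 0; 1; 2; 2; 2; 1; 1; 0; 0];
  [:: 0; 1; 0; 1; 0; 0; 0; 0; 1; 2; 1; 1; 1; 1; 0; 1; 0; 1; 1; 2; 0;
      1; 0; 0; 1; 0; 1; 2; 2; 2; 1; 1; 0; 2; 2; 2; 0; 2; 0; 0; 1; 0; 2;
      0; 1; 2; 1; 1; 0; 1; 2; 1; 0; 0; 2; 0; 1; 0; 2; 0; 1; 1; 2; 2];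
  [:: 1; 0; 2; 1; 2; 0; 1; 1; 0; 2; 0; 0; 0; 0; 1; 2; 1; 0; 0; 2; 2;
      0; 1; 1; 0; 0; 2; 1; 1; 0; 1; 0; 2; 2; 0; 2; 0; 0; 1; 2; 2; 1; 2;
      1; 2; 2; 0; 1; 1; 0; 2; 1; 1; 2; 1; 1; 0; 1; 1; 2; 0; 0; 2; 2];
  [:: 1; 0; 1; 0; 1; 0; 1; 1; 0; 1; 0; 2; 0; 0; 2; 2; 1; 0; 2; 1; 1;
      0; 1; 1; 0; 2; 0; 2; 0; 0; 1; 2; 1; 0; 0; 2; 2; 0; 1; 1; 0; 0; 2;
      1; 1; 2; 1; 0; 2; 0; 0; 2; 0; 0; 2; 1; 2; 1; 2; 1; 2; 0; 2; 1];
  [:: 1; 0; 0; 1; 1; 0; 1; 1; 0; 0; 1; 2; 2; 0; 1; 0; 1; 0; 2; 0; 0;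
      2; 1; 1; 2; 2; 0; 2; 1; 0; 1; 2; 2; 0; 2; 2; 2; 2; 1; 1; 0; 2; 0;
      1; 0; 0; 1; 1; 1; 0; 0; 2; 1; 0; 1; 2; 0; 1; 2; 1; 2; 2; 0; 0]].

(** Rotating the list of colours by [8 * k] composes the colouring with the
automorphism that adds [8 * k]. *)
Definition rotated_colourings : seq (seq nat) :=
  [seq rot (8 * k) c | c <- near_colourings, k <- iota 0 8].

Definition same_colour (c : seq nat) (xy : nat * nat) := nth 0 c xy.1 == nth 0 c xy.2.

Lemma same_colourC c x y : same_colour c (upair x y) = (nth 0 c x == nth 0 c y).
Proof. by rewrite /same_colour /upair; case: leqP => _ //=; rewrite eq_sym. Qed.

Definition defects c := filter (same_colour c) edges.

Definition colour c (x : 'Z_64) : 'I_3 := inord (nth 0 c x).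

Lemma colour_eq c x y : c \in rotated_colourings ->
  (colour c x == colour c y) = same_colour c (upair x y).
Proof.
have chk : all (all (fun i => i < 3)) rotated_colourings by vm_compute.
move/(allP chk)/(all_nthP 0)=> c3; rewrite same_colourC -(inj_eq val_inj).
have c3' i : nth 0 c i < 3.
  by have [/c3 //|ge] := ltnP i (size c); rewrite nth_default.
by rewrite /= !inordK.
Qed.

Lemma defectsP c x y : c \in rotated_colourings -> adj G64 x y ->
  colour c x = colour c y -> upair x y \in defects c.
Proof.
move=> cR xy /eqP; rewrite (colour_eq _ _ cR) mem_filter (mem_edges xy).
by move=> ->.
Qed.

(** Every edge, not only the twenty representatives, is the sole defect of
some rotated near-colouring. *)
Lemma sole_defects :
  let D := map defects rotated_colourings in all (fun e => [:: e] \in D) edges.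
Proof. by vm_compute. Qed.

Lemma sole_defect (a b : 'Z_64) : adj G64 a b ->
  exists2 c, c \in rotated_colourings & defects c = [:: upair a b].
Proof.
by move/mem_edges/(allP sole_defects)/mapP=> [c cR cab]; exists c; last exact: esym.
Qed.

Lemma contraction_colouring a b : adj G64 a b ->
  exists2 f : 'Z_64 -> 'I_3, f a = f b &
    forall x y, adj G64 x y -> f x = f y -> [set x; y] = [set a; b].
Proof.
case/sole_defect=> c cR cab; exists (colour c).
  apply/eqP; rewrite (colour_eq _ _ cR).
  have : upair a b \in defects c by rewrite cab mem_head.
  by rewrite mem_filter => /andP[].
move=> x y xy /(defectsP cR xy); rewrite cab inE => /eqP/upair_inj.
by case=> -[/val_inj-> /val_inj->]; [exact: erefl | exact: setUC].
Qed.

Section Association.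
Variables (K V : eqType) (tbl : seq (K * V)).

Definition assoc (k : K) : seq V := [seq q.2 | q <- tbl & q.1 == k].

Lemma mem_assoc k v : (v \in assoc k) = ((k, v) \in tbl).
Proof.
apply/mapP/idP=> [[[a b]]|kv]; last first.
  by exists (k, v); rewrite // mem_filter eqxx.
by rewrite mem_filter => /andP[/eqP /= -> ab] ->.
Qed.

Lemma assoc_nil k : k \notin undup (unzip1 tbl) -> assoc k = [::].
Proof.
rewrite mem_undup; case E: (assoc k) => [//|v s] /mapP[]; exists (k, v) => //.
by rewrite -mem_assoc E mem_head.
Qed.

End Association.

Definition meets (uv e : nat * nat) :=
  [|| e.1 == uv.1, e.1 == uv.2, e.2 == uv.1 | e.2 == uv.2].

Definition unspoilt (uv : nat * nat) (B : seq (nat * nat))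
    (d : seq nat * seq (nat * nat)) :=
  all (meets uv) d.2 && ~~ has (same_colour d.1) B.

(** A single near-colouring serves all the pairs critical for [uv] together. *)
Lemma critical_pairs_checked : let D := [seq (c, defects c) | c <- rotated_colourings] in
  all (fun uv => let B := assoc critical_table uv in
         (size B <= 3) && has (unspoilt uv B) D)
      (undup (unzip1 critical_table)).
Proof. by vm_compute. Qed.

(* From here on these tables are only referred to by name; unfolding them
during unification would start the searches again. *)
Opaque defects edges rotated_colourings near_colourings critical_table.

Definition critical_for (u v : 'Z_64) := assoc critical_table (upair u v).

Lemma mem_critical_for (u v x y : 'Z_64) :
  (upair x y \in critical_for u v) = critical u v x y.
Proof. exact: mem_assoc. Qed.

Lemma critical_pair_cases (u v : 'Z_64) : critical_for u v = [::] \/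
  size (critical_for u v) <= 3 /\
  exists c, [/\ c \in rotated_colourings, all (meets (upair u v)) (defects c)
              & ~~ has (same_colour c) (critical_for u v)].
Proof.
rewrite /critical_for.
have [crit|/assoc_nil->] := boolP (upair u v \in undup (unzip1 critical_table));
  last by left.
have /andP[szB /hasP[[c D] /mapP[c' cR [-> ->]]]] := allP critical_pairs_checked _ crit.
by move=> /andP[meet nsame]; right; split=> //; exists c'; split.
Qed.

Lemma meets_mem (u v x y : 'Z_64) :
  meets (upair u v) (upair x y) -> (x \in [set u; v]) || (y \in [set u; v]).
Proof.
have E := fun a b : 'Z_64 => inj_eq val_inj a b.
rewrite /meets /upair !inE; case: (leqP u v) => _; case: (leqP x y) => _ /=;
  by rewrite !E => /or4P[] ->; rewrite ?orbT.
Qed.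

Lemma neighbour_exists u : exists w, adj G64 u w.
Proof.
have chk : all (fun x => neighbours x != [::]) (iota 0 64) by vm_compute.
move: (allP chk _ (Z64_iota u)); case E: (neighbours u) => [//|w s] _.
have w64 : w < (Zp_trunc 64).+2.
  have : w \in neighbours u by rewrite E mem_head.
  by rewrite (mem_neighbours _ (ltn_ord u)) => /andP[].
by exists (Ordinal w64); rewrite adjE E mem_head.
Qed.

(** If nothing is critical for [u], [v], any near-colouring whose defect is an
edge at [u] will do. Otherwise the near-colouring has to be chosen so that it
also separates the critical pairs. *)
Lemma deletion_colouring (u v : 'Z_64) :
  exists2 f : 'Z_64 -> 'I_3,
    forall x y, x \notin [set u; v] -> y \notin [set u; v] -> adj G64 x y -> f x != f y
    & forall x y, critical u v x y -> f x != f y.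
Proof.
case: (critical_pair_cases u v) => [noB|[_ [c [cR meet nB]]]].
  have [w uw] := neighbour_exists u.
  have [f _ mono] := contraction_colouring uw; exists f => x y.
    move=> xuv yuv xy; apply/eqP=> /(mono _ _ xy) E.
    have := set21 u w; rewrite -E => /set2P[] uE; first by rewrite -uE set21 in xuv.
    by rewrite -uE set21 in yuv.
  by rewrite -mem_critical_for noB.
exists (colour c) => x y.
  move=> xuv yuv xy; apply/eqP=> /(defectsP cR xy) /(allP meet) /meets_mem.
  by rewrite (negbTE xuv) (negbTE yuv).
rewrite -mem_critical_for (colour_eq _ _ cR) => xyB.
by apply: contra nB => same; apply/hasP; exists (upair x y).
Qed.

Lemma size_critical_for u v : size (critical_for u v) <= 3.
Proof. by case: (critical_pair_cases u v) => [->|[]]. Qed.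

(** * Deletions and identifications in G64 *)

Lemma criticalC u v x y : critical u v x y = critical u v y x.
Proof. by rewrite /critical [upair x y]upairC. Qed.

(** A path of [G64] that avoids [u] and [v] survives their deletion, so only
critical pairs can be far apart afterwards. *)
Lemma far_critical u v (x y : {z | z \notin [set u; v]}) : x != y ->
  (forall p, is_path (delete G64 [set u; v]) x y p -> 4 < size p) ->
  critical u v (val x) (val y).
Proof.
move=> xy far.
have [xu xv] := notin_set2 (valP x); have [yu yv] := notin_set2 (valP y).
case: (@short_path_avoiding (val x) (val y) u v xy xu yu xv yv) => //.
case=> p [Gp sp up vp]; have [|q Gq sq] := @lift_path _ _ [set u; v] x y p Gp.
  by apply/allP=> z zp; rewrite !inE negb_or (memPn up) // (memPn vp).
by have := far q Gq; rewrite sq ltnNge sp.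
Qed.

Definition ends_of n (A : {set 'I_n}) (q : nat * nat) : {set {z | z \notin A}} :=
  [set z : {z | z \notin A} |
    ((sval z : 'I_n) == q.1 :> nat) || ((sval z : 'I_n) == q.2 :> nat)].

Lemma ends_of_upair n (A : {set 'I_n}) (x y : {z | z \notin A}) :
  [set x; y] = ends_of A (upair (sval x) (sval y)).
Proof.
have eq_val (a b : {z | z \notin A}) :
  (a == b) = ((sval a : 'I_n) == (sval b : 'I_n) :> nat) by [].
apply/setP=> z; rewrite in_set2 in_set !eq_val /upair.
by case: leqP => _ //=; rewrite orbC.
Qed.

Lemma num_girth_preserving_le3 (u v : 'Z_64) :
  num_girth_preserving (delete G64 [set u; v]) <= 3.
Proof.
apply: leq_trans (size_critical_for u v).
apply: (num_girth_preserving_le (ends := ends_of [set u; v])) => x y gp.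
exists (upair (sval x) (sval y)); last exact: ends_of_upair.
rewrite mem_critical_for; apply: far_critical => [|p]; first by case/and3P: gp.
exact: girth_preserving_far gp.
Qed.

(** The colouring separates all pairs that could ever be added, so it stays
proper whatever sequence of additions is performed. *)
Lemma additions_colourable u v (H : sgraph {z : 'Z_64 | z \notin [set u; v]}) :
  additions (delete G64 [set u; v]) H -> colourable H 3.
Proof.
move=> addH; have [f proper sep] := deletion_colouring u v.
exists (fun x => f (val x)) => x y xy.
have neq : x != y by apply: contraTneq xy => ->; rewrite adj_irr.
have [Gxy|far|far] := additions_adj addH xy.
- exact: proper (valP x) (valP y) Gxy.
- by apply: sep; apply: far_critical.
by apply: sep; rewrite criticalC; apply: far_critical; rewrite // eq_sym.
Qed.

Lemma deleted_short_path v (x y : {z : 'Z_64 | z \notin [set v]}) :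
  exists2 p, is_path (delete G64 [set v]) x y p & size p <= 4.
Proof.
have [->|xy] := eqVneq x y; first by exists [::]; rewrite // /is_path /= eqxx.
have vy : val v != val (val y) by move: (valP y); rewrite inE eq_sym.
have [p [Gp sp vp]] := has_ending (robust_avoids (robustG xy) vy).
have [|q Gq sq] := @lift_path _ _ [set v] x y p Gp.
  apply/allP=> z zp; rewrite !inE; apply: contraNneq vp => <-.
  exact: map_f.
by exists q; rewrite ?sq.
Qed.

Lemma nonadjacent_identification u v : u != v -> ~~ adj G64 u v ->
  identification_creates_short_cycle G64 u v.
Proof.
move=> uv nadj; have [p Gp sp] := path_345 uv nadj.
exact: identification_short_cycle girth_G64 Gp sp.
Qed.

Lemma contraction_colourable u v : adj G64 u v -> colourable (identify G64 u v) 3.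
Proof.
move=> uv; have [f fuv mono] := contraction_colouring uv.
exact: identify_colourable mono.
Qed.

(** * Counting the orbits of pairs *)

Lemma adj_shift8 x y : adj G64 (shift8 x) (shift8 y) = adj G64 x y.
Proof.
have arc (a b : 'Z_64) : G64_arc (shift8 a) (shift8 b) = G64_arc a b.
  have shiftE (z : 'Z_64) : shift8 z = (z + 8) %% 64 :> nat by [].
  rewrite /G64_arc !shiftE; apply: eq_has => -[i t] /=.
  rewrite (modn_dvdm _ (isT : 8 %| 64)) modnDr modnDml addnAC eqn_modDr.
  by rewrite [b %% 64]modn_small ?(ltn_ord b).
by rewrite /= /G64_adj !arc.
Qed.

Section Orbits.
Variables (T : finType) (f : T -> T).
Hypothesis f_inj : injective f.

Lemma order_eq n x : 0 < n -> iter n f x = x ->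
  (forall d, 0 < d < n -> iter d f x != x) -> order f x = n.
Proof.
move=> n_gt0 fnx min_n; have le_n : order f x <= n.
  rewrite leqNgt; apply/negP=> /findex_iter.
  by rewrite fnx findex0 => n0; rewrite -n0 in n_gt0.
apply/eqP; rewrite eqn_leq le_n leqNgt; apply/negP=> lt_n.
have := min_n (order f x); rewrite order_gt0 lt_n iter_order // eqxx.
by move=> /(_ isT).
Qed.

End Orbits.

Lemma fcardID (T : finType) (f : T -> T) (a b : {pred T}) :
  fcard f a = fcard f [predI a & b] + fcard f [predD a & b].
Proof.
rewrite /n_comp_mem -(cardID b); congr (_ + _); apply: eq_card => x;
  by rewrite !inE /=; case: (froots f x); case: (x \in a); case: (x \in b).
Qed.

Lemma iter_shift8 d x : iter d shift8 x = (x + (8 * d)%:R)%R.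
Proof.
elim: d => [|d /= ->]; first by rewrite muln0 addr0.
by rewrite /shift8 -addrA -natrD mulnS addnC.
Qed.

Lemma shift8_bij : bijective shift8.
Proof. by exists (fun x => x - 8%:R)%R => x; rewrite /shift8 ?addrK ?subrK. Qed.

Local Notation shift_set := (fun e : {set 'Z_64} => shift8 @: e).

Lemma shift_set_inj : injective shift_set.
Proof. exact: imset_inj (bij_inj shift8_bij). Qed.

Lemma iter_shift_set d (e : {set 'Z_64}) :
  iter d shift_set e = [set (x + (8 * d)%:R)%R | x in e].
Proof.
elim: d => [|d /= ->].
  by rewrite -[LHS]imset_id; apply: eq_imset => x; rewrite addr0.
by rewrite -imset_comp; apply: eq_imset => x /=; rewrite -!iter_shift8.
Qed.

Lemma iter_shift_pair d x y :
  iter d shift_set [set x; y] = [set (x + (8 * d)%:R)%R; (y + (8 * d)%:R)%R].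
Proof. by rewrite iter_shift_set imsetU1 imset_set1. Qed.

Local Notation pairs := [pred e : {set 'Z_64} | #|e| == 2].
Local Notation antipodal := [pred e : {set 'Z_64} | iter 4 shift_set e == e].

(** A rotation by [8 * d] that is not trivial fixes no vertex, so it can only
swap the two elements of [e]; then [16 * d] vanishes modulo 64. *)
Lemma pair_period d (e : {set 'Z_64}) : e \in pairs -> 0 < d < 8 ->
  iter d shift_set e = e -> d = 4.
Proof.
rewrite inE => /cards2P[x [y [xy ->]]] d8; rewrite iter_shift_pair => E.
(* The seven possible values of [d] are tested by evaluation. *)
have d_in : d \in iota 1 7 by rewrite mem_iota.
have d_neq0 : ((8 * d)%:R != 0 :> 'Z_64)%R.
  by apply: (allP (_ : all (fun d => (8 * d)%:R != 0 :> 'Z_64)%R _) d d_in); vm_compute.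
have twice : ((8 * d)%:R + (8 * d)%:R == 0 :> 'Z_64)%R.
  have [[/eqP + _]|[<- /eqP]] := set2_inj xy E.
    by rewrite -subr_eq0 addrC addKr (negbTE d_neq0).
  by rewrite -subr_eq0 addrC -[(x + _ + _)%R]addrA addKr.
apply/eqP; move: twice; apply/implyP; move: d d_in {d8 E d_neq0}.
by apply/allP; vm_compute.
Qed.

Definition antipodal_pair (i : 'I_32) : {set 'Z_64} :=
  [set inZp i; inZp (i + 32)].

Lemma antipodal_pair_inj : injective antipodal_pair.
Proof.
move=> i j E; have := set21 (inZp i : 'Z_64) (inZp (i + 32)).
rewrite -/(antipodal_pair i) E => /set2P[] /(congr1 val) /=.
  by rewrite !modn_small; [exact: val_inj | apply: (ltn_trans (ltn_ord _))..].
rewrite !modn_small.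
- by move=> ij; have := ltn_ord i; rewrite ij ltnNge leq_addl.
- by rewrite (@ltn_add2r 32 j 32).
by apply: (ltn_trans (ltn_ord _)).
Qed.

(** The pairs of period 4 are the pairs of points at distance 32 around the
circle. *)
Lemma antipodal_pairsE :
  [predI pairs & antipodal] =i [set antipodal_pair i | i : 'I_32].
Proof.
have add32 (x : 'Z_64) : (x + (8 * 4)%:R)%R = inZp (x + 32) :> 'Z_64.
  by apply: val_inj; rewrite /= modnDmr.
have n32 : ((8 * 4)%:R == 0 :> 'Z_64)%R = false by vm_compute.
have n64 : ((8 * 4)%:R + (8 * 4)%:R = 0 :> 'Z_64)%R by apply/eqP; vm_compute.
move=> e; rewrite [LHS]inE; apply/andP/imsetP=> [[]|[i _ ->]].
  rewrite inE => /cards2P[x [y [xy ->]]]; rewrite inE iter_shift_pair => /eqP E.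
  have yE : y = inZp (x + 32).
    have [[+ _]|[<- _]] := set2_inj xy E; last exact: add32.
    by move/eqP; rewrite -subr_eq0 addrC addKr n32.
  have [x_lt|x_ge] := ltnP x 32.
    exists (Ordinal x_lt); first by [].
    rewrite /antipodal_pair /= yE.
    by congr [set _; _]; apply: val_inj; rewrite /= modn_small.
  have x_lt : x - 32 < 32 by rewrite ltn_subLR //; apply: ltn_ord.
  exists (Ordinal x_lt); first by [].
  have -> : antipodal_pair (Ordinal x_lt) = [set inZp (x - 32); inZp (x - 32 + 32)].
    by rewrite /antipodal_pair.
  rewrite (subnK x_ge) valZpK setUC yE; congr [set _; _]; apply: val_inj.
  have -> : x + 32 = x - 32 + 64 by rewrite -[in LHS](subnK x_ge) -addnA.
  by rewrite -[LHS]modn_mod -[RHS]modn_mod /= modnDr.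
set x : 'Z_64 := inZp i; have -> : antipodal_pair i = [set x; (x + (8 * 4)%:R)%R].
  by rewrite add32; congr [set _; _]; apply: val_inj; rewrite /= modnDml.
split; first by rewrite inE cards2 -subr_eq0 opprD addNKr oppr_eq0 n32.
by rewrite inE iter_shift_pair -addrA n64 addr0 setUC.
Qed.

Lemma fcard_pairs : fcard shift_set pairs = 256.
Proof.
have inj := shift_set_inj; have sym := fconnect_sym inj.
have card_pairs : #|pairs| = 2016.
  by rewrite -cardsE card_draws card_ord.
have card4 : #|[predI pairs & antipodal]| = 32.
  by rewrite (eq_card antipodal_pairsE) (card_imset _ antipodal_pair_inj) card_ord.
have card8 : #|[predD pairs & antipodal]| = 1984.
  by apply/eqP; rewrite -(eqn_add2l 32) -[X in X + _]card4 cardID card_pairs.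
have closed_pairs e : (shift_set e \in pairs) = (e \in pairs).
  by rewrite !inE (card_imset _ (bij_inj shift8_bij)).
have closed_antipodal e : (shift_set e \in antipodal) = (e \in antipodal).
  by rewrite !inE -iterSr iterS (inj_eq inj).
have period8 e : iter 8 shift_set e = e.
  rewrite iter_shift_set -[RHS]imset_id; apply: eq_imset => x.
  by rewrite (_ : (8 * 8)%:R = 0)%R ?addr0 //; apply/eqP; vm_compute.
rewrite (fcardID _ _ antipodal).
have -> : fcard shift_set [predI pairs & antipodal] = 8.
  apply/eqP; rewrite -(eqn_pmul2r (isT : 0 < 4)) (fcard_order_set inj) ?card4 //.
    apply/subsetP=> e /andP[e2 /eqP e4]; apply/eqP/order_eq => // d d4.
    have d8 : 0 < d < 8 by case/andP: d4 => -> /ltn_trans->.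
    by apply/eqP=> /(pair_period e2 d8) dE; rewrite dE in d4.
  apply: intro_closed => // e _ /eqP<-.
  by rewrite ![_ \in [predI _ & _]]inE closed_pairs closed_antipodal.
have -> // : fcard shift_set [predD pairs & antipodal] = 248.
apply/eqP; rewrite -(eqn_pmul2r (isT : 0 < 8)) (fcard_order_set inj) ?card8 //.
  apply/subsetP=> e /andP[e4 e2]; apply/eqP/order_eq => // d d8.
  apply: contra e4 => /eqP E; have d4 := pair_period e2 d8 E.
  by rewrite d4 in E; apply/eqP.
apply: intro_closed => // e _ /eqP<-.
by rewrite ![_ \in [predD _ & _]]inE closed_pairs closed_antipodal.
Qed.

(** * Graphs obtained from G64 *)

(** In every case the graph is 3-colourable, except after the identification
of two nonadjacent vertices, when it has a cycle of length at most 5. *)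
Lemma obtained_not_4chromatic_girth6 (T : finType) (H : sgraph T) :
  obtained_from G64 H -> #|T| < 64 -> ~ (chromatic H 4 /\ has_girth H 6).
Proof.
have no4 (T' : finType) (K : sgraph T') :
  colourable K 3 -> ~ (chromatic K 4 /\ has_girth K 6).
  by move=> K3 [[_ /(_ _ K3)]].
case=> {T H} [A H|u v uv].
  move=> A2 addH; rewrite card_sig => A64; apply: no4.
  (* At least one vertex is deleted, and a single one is the case [u = v]. *)
  have [u [v uvA]] : exists u v, A = [set u; v].
    move: A2; rewrite leq_eqVlt ltnS leq_eqVlt ltnS leqn0 cards_eq0.
    case/or3P=> [/cards2P[u [v [_ ->]]]|/cards1P[u ->]|/eqP A0]; first by exists u, v.
      by exists u, u; rewrite setUid.
    by move: A64; rewrite A0 (eq_card (_ : _ =i 'Z_64)) ?card_ord // => z; rewrite !inE.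
  by rewrite uvA in H addH *; apply: additions_colourable addH.
move=> _; have [adjuv|nadj] := boolP (adj G64 u v).
  exact/no4/contraction_colourable.
case/existsP: (nonadjacent_identification uv nadj) => k /existsP[p /andP[Hp _]].
by case=> _ [_ /(_ _ Hp)]; rewrite size_tuple leqNgt ltn_ord.
Qed.

Theorem proposition5 :
  (* (i) *)
  [/\ has_diameter G64 4,
      (forall x y : 'Z_64, ~ dist_ge G64 x y 5),
      (forall x y : 'Z_64, x != y -> ~~ adj G64 x y ->
         addition_creates_short_cycle G64 x y),
      (forall (v : 'Z_64) (x y : {z : 'Z_64 | z \notin [set v]}),
         ~ dist_ge (delete G64 [set v]) x y 5)
    & (forall (v : 'Z_64) (x y : {z : 'Z_64 | z \notin [set v]}),
         x != y -> ~~ adj (delete G64 [set v]) x y ->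
         addition_creates_short_cycle (delete G64 [set v]) x y)] /\
  (* (ii) *)
  [/\ bijective shift8,
      (forall x y : 'Z_64, adj G64 (shift8 x) (shift8 y) = adj G64 x y),
      fcard (fun e : {set 'Z_64} => shift8 @: e)
            [pred e : {set 'Z_64} | #|e| == 2] = 256
    & (forall u v : 'Z_64, u != v ->
         num_girth_preserving (delete G64 [set u; v]) <= 3 /\
         (forall H : sgraph {z : 'Z_64 | z \notin [set u; v]},
            maximal_additions (delete G64 [set u; v]) H -> colourable H 3))] /\
  (* (iii) *)
  [/\ (forall u v : 'Z_64, u != v -> ~~ adj G64 u v ->
         exists2 p : seq 'Z_64,
           is_path G64 u v p & size p \in [:: 3; 4; 5]),
      (forall u v : 'Z_64, u != v -> ~~ adj G64 u v ->
         identification_creates_short_cycle G64 u v)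
    & (forall u v : 'Z_64, adj G64 u v -> colourable (identify G64 u v) 3)] /\
  (* conclusion *)
  (forall (T : finType) (H : sgraph T), obtained_from G64 H -> #|T| < 64 ->
     ~ (chromatic H 4 /\ has_girth H 6)).
Proof.
split; [|split; [|split]].
- split; first exact: diameter_G64.
  + move=> x y far; have [p Gp sp] := short_path x y.
    by have := far p Gp; rewrite leqNgt ltnS sp.
  + move=> x y xy nadj; have [p Gp sp] := short_path x y.
    exact: short_path_blocks_addition Gp sp.
  + move=> v x y far; have [p Gp sp] := deleted_short_path x y.
    by have := far p Gp; rewrite leqNgt ltnS sp.
  move=> v x y xy nadj; have [p Gp sp] := deleted_short_path x y.
  exact: short_path_blocks_addition Gp sp.
- split; [exact: shift8_bij | exact: adj_shift8 | exact: fcard_pairs |].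
  move=> u v _; split; first exact: num_girth_preserving_le3.
  by move=> H [/additions_colourable].
- split; [exact: path_345 | exact: nonadjacent_identification|].
  exact: contraction_colourable.
exact: obtained_not_4chromatic_girth6.
Qed.
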